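(* Take $n=6$ and $1\le k\le 3$. (1) For $k=1$ and for $k=3$, there is no balanced $(6,k;\alpha,\beta,\gamma,\delta)$-two-chunk cyclic metric space $X$ (for any $\alpha,\beta,\gamma,\delta>0$) for which $\lim_{t\to0^+}\mathrm{Mag}(tX)$ exists as a finite real number and is less than $1$. (2) For $k=2$: for every $R\in\mathbb{R}\setminus\{1\}$ there exist $\alpha,\beta,\gamma,\delta>0$ and a balanced $(6,2;\alpha,\beta,\gamma,\delta)$-two-chunk cyclic metric space $X$ such that $\lim_{t\to 0^+}\mathrm{Mag}(tX)=R$. (3) In particular, there exists a finite metric space $X$ with exactly twelve points such that $\lim_{t\to0^+}\mathrm{Mag}(tX)<1$.
   Context: Magnitude: for a finite metric space $(X,d)$ with $X=\{x_1,\dots,x_m\}$, the zeta matrix is $Z_X=(e^{-d(x_i,x_j)})_{1\le i,j\le m}$. A weighting is a vector $w\in\mathbb{R}^m$ with $Z_Xw=(1,\dots,1)^T$. If a weighting exists, the magnitude is $\mathrm{Mag}(X)=\sum_{i=1}^m w_i$ for any weighting $w$ (independent of the choice, since $Z_X$ is symmetric); it is not required that $Z_X$ be invertible. For $t>0$, $tX$ denotes the metric space $(X,td)$. A limit as $t\to0^+$ of $\mathrm{Mag}(tX)$ refers to $\mathrm{Mag}(tX)$ being defined for all sufficiently small $t>0$. A distance matrix is a real symmetric matrix with zero diagonal, strictly positive off-diagonal entries, and entries satisfying all triangle inequalities $D_{ij}\le D_{i\ell}+D_{\ell j}$; it generates a finite metric space on its index set. Two-chunk cyclic spaces: for integers $n\ge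 2$, $1\le k\le\lfloor n/2\rfloor$ and reals $\alpha,\beta,\gamma,\delta>0$, the $(n,k;\alpha,\beta,\gamma,\delta)$-two-chunk cyclic matrix $D_{n,k}(\alpha,\beta,\gamma,\delta)$ is the symmetric $2n\times 2n$ matrix indexed by $\{a_0,\dots,a_{n-1}\}\sqcup\{b_0,\dots,b_{n-1}\}$ with $D(a_i,a_i)=D(b_i,b_i)=0$, $D(a_i,a_j)=\alpha$ and $D(b_i,b_j)=\beta$ for $i\ne j$, and $D(a_i,b_j)=D(b_j,a_i)=\gamma$ if $j\equiv i+s\pmod n$ for some $s\in\{0,1,\dots,k-1\}$, and $=\delta$ otherwise. When this matrix is a distance matrix, the metric space it generates is called an $(n,k;\alpha,\beta,\gamma,\delta)$-two-chunk cyclic metric space and is denoted $X_{n,k}(\alpha,\beta,\gamma,\delta)$. Balanced condition: such a space is called balanced if $2\bigl(k\gamma+(n-k)\delta\bigr)=(n-1)(\alpha+\beta)$. *)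

(* Defs.v *)
From HB Require Import structures.
From mathcomp Require Import all_boot all_order all_algebra.
From mathcomp Require Import all_classical all_reals all_analysis.
Set Implicit Arguments.
Unset Strict Implicit.
Unset Printing Implicit Defensive.
Import Order.TTheory GRing.Theory Num.Theory.
Import numFieldNormedType.Exports.
Local Open Scope classical_set_scope.
Local Open Scope ring_scope.

(* A square real array indexed by a finite type [T] is a function
   [T -> T -> R]; when it is a distance matrix, [(T, d)] is the finite metric
   space it generates. *)

Definition distance_matrix (R : realType) (T : finType) (d : T -> T -> R) : Prop :=
  [/\ forall x, d x x = 0,
      forall x y, x != y -> 0 < d x y,
      forall x y, d x y = d y x &
      forall x y z, d x y <= d x z + d z y].

Definition rescale (R : realType) (T : finType) (t : R) (d : T -> T -> R)
  : T -> T -> R := fun x y => t * d x y.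

Definition zeta_matrix (R : realType) (T : finType) (d : T -> T -> R) : 'M[R]_#|T| :=
  \matrix_(i, j) expR (- d (enum_val i) (enum_val j)).

Definition weighting (R : realType) (T : finType) (d : T -> T -> R)
  (w : 'cV[R]_#|T|) : Prop := zeta_matrix d *m w = const_mx 1.

Definition has_magnitude (R : realType) (T : finType) (d : T -> T -> R) : Prop :=
  exists w, weighting d w.

(* The choice of weighting is immaterial, see [MagE]; the value is 0 (and
   meaningless) when [has_magnitude d] fails. *)
Definition Mag (R : realType) (T : finType) (d : T -> T -> R) : R :=
  \sum_i (xget 0 [set w | weighting d w]) i 0.

Lemma MagE (R : realType) (T : finType) (d : T -> T -> R) (w : 'cV[R]_#|T|) :
  (forall x y, d x y = d y x) -> weighting d w -> Mag d = \sum_i w i 0.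
Proof.
move=> dC dw; rewrite /Mag.
set v := xget _ _.
have dv : weighting d v by apply: (@xgetPex _ 0 [set w | weighting d w]); exists w.
have ZT : (zeta_matrix d)^T = zeta_matrix d.
  by apply/matrixP => i j; rewrite !mxE dC.
have sumE (u : 'cV[R]_#|T|) : \sum_i u i 0 = ((const_mx 1 : 'cV_#|T|)^T *m u) 0 0.
  by rewrite mxE; apply: eq_bigr => i _; rewrite !mxE mul1r.
rewrite !sumE -{1}dw trmx_mul ZT -mulmxA dv.
have -> : w^T *m const_mx 1 = ((const_mx 1 : 'cV_#|T|)^T *m w)^T :> 'M[R]_1.
  by rewrite trmx_mul trmxK.
by rewrite mxE.
Qed.

(* [Mag (t X)] is defined for all small [t > 0] and tends to the real [l] as
   [t -> 0+]. *)
Definition small_scale_Mag (R : realType) (T : finType) (d : T -> T -> R) (l : R)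
  : Prop :=
  (\forall t \near 0^'+, has_magnitude (rescale t d)) /\
  Mag (rescale t d) @[t --> 0^'+] --> l.

(* [inl i] is the point a_i and [inr j] is the point b_j. *)
Definition two_chunk_matrix (R : realType) (n k : nat) (alpha beta gamma delta : R)
  (x y : 'I_n + 'I_n) : R :=
  let cross (i j : 'I_n) :=
    if [exists s : 'I_k, (j == i + s %[mod n])%N] then gamma else delta in
  match x, y with
  | inl i, inl j => if i == j then 0 else alpha
  | inr i, inr j => if i == j then 0 else beta
  | inl i, inr j => cross i j
  | inr j, inl i => cross i j
  end.

Definition two_chunk_space (R : realType) (n k : nat) (alpha beta gamma delta : R)
  : Prop :=
  [/\ (2 <= n)%N, (1 <= k <= n./2)%N,
      [/\ 0 < alpha, 0 < beta, 0 < gamma & 0 < delta] &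
      distance_matrix (two_chunk_matrix (n := n) k alpha beta gamma delta)].

Definition balanced (R : realType) (n k : nat) (alpha beta gamma delta : R) : Prop :=
  2 * (k%:R * gamma + (n - k)%N%:R * delta) = (n - 1)%N%:R * (alpha + beta).

(* Main.v *)
Require Import Defs.
From HB Require Import structures.
From mathcomp Require Import all_boot all_order all_algebra.
From mathcomp Require Import all_classical all_reals all_analysis.
From mathcomp Require Import zify ring lra.
Import Order.TTheory GRing.Theory Num.Theory.
Import numFieldNormedType.Exports.
Set Implicit Arguments.
Unset Strict Implicit.
Local Open Scope classical_set_scope.
Local Open Scope ring_scope.

(** In a two-chunk cyclic space all rows of the zeta matrix indexed by one
    chunk have the same sum over each of the two chunks, and likewise for the
    columns.  (In the lemmas [a], [b], [c], [d] are the four distances.)  Write [A] and [B] for the row sums inside the two chunks and [C]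
    for the row sum across chunks.  Summing the equations of a weighting over
    each chunk shows that its totals [p] and [q] on the two chunks satisfy
    [A p + C q = n] and [C p + B q = n] ([weighting_chunk_totals]), hence
    [(A B - C^2) Mag = n (A + B - 2 C)]; conversely, when [A B - C^2] is
    nonzero a weighting constant on each chunk exists.

    Scale by [t] and let [t] tend to 0.  The balanced condition says exactly
    that the terms of order [t] of [A + B - 2 C] cancel, and then both sides are
    of order [t^2].  With
      [D = (n-1)/2 (alpha^2 + beta^2) - k (n-k) (gamma - delta)^2] and
      [E = ((n-1) (alpha - beta) / 2)^2],
    the second-order coefficients are [D] for [A B - C^2] ([cvg_determinant])
    and [D + E] for [n (A + B - 2 C)] ([cvg_numerator]).  A finite limit [l] of
    the magnitude therefore satisfies [D (l - 1) = E], and for [D != 0] the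
    limit exists.  When [alpha = beta] one has [E = 0], but adding the two
    equations above directly gives [(A + C) Mag = 2 n], so [l = 1].

    Hence a limit below 1 forces [D < 0].  For [n = 6] this is impossible when
    [k] is 1 or 3: the triangle inequalities (together with balancedness for
    [k = 3]) bound [|gamma - delta|] too strongly.  For [k = 2] there is room:
    near [alpha = beta = 1] all triangle inequalities hold strictly on a
    balanced space with [D = 0], so a small perturbation with [alpha != beta]
    can realise any prescribed nonzero ratio [E / D = l - 1]. *)

(** * Expansion of the exponential at 0 *)

Lemma is_derive_expR_lin (R : realType) (a t : R) :
  is_derive t 1 (fun t => expR (- (t * a))) (- a * expR (- (t * a))).
Proof.
have H : is_derive t 1 (fun t => - (t * a)) (- a).
  apply: is_derive_eq; rewrite scaler0 add0r.
  by rewrite /GRing.scale /= mulr1.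
by rewrite mulrC; apply: is_derive1_comp.
Qed.

Lemma cvg_id_at_right0 (R : realType) : (t : R) @[t --> 0^'+] --> (0 : R).
Proof. exact: cvg_at_right_filter. Qed.

Lemma cvg_expR_lin (R : realType) (a : R) :
  expR (- (t * a)) @[t --> 0^'+] --> (1 : R).
Proof.
rewrite -[X in _ --> X](@expR0 R); apply: continuous_cvg; first exact: continuous_expR.
rewrite -[X in _ --> X]oppr0 -[X in - X](mul0r a).
by apply: cvgN; apply: cvgMl; exact: cvg_id_at_right0.
Qed.

Lemma cvg_expR_order1 (R : realType) (a : R) :
  (1 - expR (- (t * a))) / t @[t --> 0^'+] --> a.
Proof.
have df (x : R) : x \in `]0, 1[ ->
    is_derive x 1 (fun t => 1 - expR (- (t * a))) (a * expR (- (x * a))).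
  have H := is_derive_expR_lin a x => _.
  by apply: is_derive_eq; rewrite add0r mul1r mulNr opprK.
have dg (x : R) : x \in `]0, 1[ -> is_derive x 1 (@id R) 1 by move=> _; exact: is_derive_id.
apply: (lhopital_at_right ltr01 df dg).
- rewrite -[X in _ --> X](subrr 1); apply: cvgB; [exact: cvg_cst|exact: cvg_expR_lin].
- exact: cvg_id_at_right0.
- by move=> x _; rewrite oner_neq0.
- rewrite (_ : (fun _ => _) = (fun t => a * expR (- (t * a)))); last first.
    by apply/funext => t; rewrite divr1.
  by rewrite -[X in _ --> X](mulr1 a); apply: cvgMr; exact: cvg_expR_lin.
Qed.

(** L'Hopital's rule reduces the second-order coefficient to the first-order
    one. *)
Lemma cvg_expR_order2 (R : realType) (a : R) :
  (expR (- (t * a)) - 1 + t * a) / t ^+ 2 @[t --> 0^'+] --> a ^+ 2 / 2.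
Proof.
have df (x : R) : x \in `]0, 1[ -> is_derive x 1 (fun t => expR (- (t * a)) - 1 + t * a)
    (a * (1 - expR (- (x * a)))).
  have H := is_derive_expR_lin a x => _.
  apply: is_derive_eq; rewrite subr0 scaler0 add0r /GRing.scale /=; ring.
have dg (x : R) : x \in `]0, 1[ -> is_derive x 1 (fun t : R => t ^+ 2) (2 * x).
  by move=> _; apply: is_derive_eq; rewrite /GRing.scale /=; ring.
apply: (lhopital_at_right ltr01 df dg).
- rewrite -[X in _ --> X](add0r 0) -[X in _ --> X + _](subrr 1).
  apply: cvgD.
    by apply: cvgB; [exact: cvg_expR_lin|exact: cvg_cst].
  by rewrite -[X in _ --> X](mul0r a); apply: cvgMl; exact: cvg_id_at_right0.
- rewrite -[X in _ --> X](mulr0 0); apply: cvgM; exact: cvg_id_at_right0.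
- by move=> x /[!in_itv]/= /andP[x0 _]; rewrite mulf_neq0// ?pnatr_eq0// gt_eqF.
- have -> : (fun t => a * (1 - expR (- (t * a))) / (2 * t)) =
    (fun t => a / 2 * ((1 - expR (- (t * a))) / t)).
    by apply/funext => t; rewrite invfM; ring.
  by rewrite expr2 mulrAC; apply: cvgMr; exact: cvg_expR_order1.
Qed.

(** * Row sums of the zeta matrix and totals of a weighting *)

(** Moving from the enumeration of the points to the points themselves makes
    the chunk structure of the index set visible in the sums. *)
Lemma weightingP (R : realType) (T : finType) (d : T -> T -> R)
    (w : 'cV[R]_#|T|) :
  weighting d w <->
  forall x, \sum_y expR (- d x y) * w (enum_rank y) 0 = 1.
Proof.
have E i : (zeta_matrix d *m w) i 0 =
    \sum_y expR (- d (enum_val i) y) * w (enum_rank y) 0.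
  rewrite mxE (reindex (@enum_rank T)); last first.
    by apply: onW_bij; exact: enum_rank_bij.
  by apply: eq_bigr => y _; rewrite mxE enum_rankK.
split=> [dw x|dw].
  by rewrite -[x in d x]enum_rankK -E dw mxE.
by apply/matrixP => i j; rewrite ord1 E dw mxE.
Qed.

Lemma sum_enum_rank (R : realType) (T : finType) (w : 'cV[R]_#|T|) :
  \sum_i w i 0 = \sum_x w (enum_rank x) 0.
Proof.
rewrite (reindex (@enum_rank T)) //=.
by apply: onW_bij; exact: enum_rank_bij.
Qed.

(** This is the test in [two_chunk_matrix], so that the two are convertible. *)
Definition cyclic_adj (n k : nat) (i j : 'I_n) : bool :=
  [exists s : 'I_k, (j == i + s %[mod n])%N].

(** The neighbours of [i] are the residues [i + s] with [s < k], which are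
    distinct since [k <= n]. *)
Lemma card_cyclic_adj_row (n k : nat) (i : 'I_n) : (k <= n)%N ->
  #|[pred j | cyclic_adj k i j]| = k.
Proof.
move=> kn; have n0 : (0 < n)%N by case: n i kn => [[]|].
pose f (s : 'I_k) : 'I_n := Ordinal (ltn_pmod (i + s) n0).
rewrite -[RHS]card_ord -(card_imset _ (_ : injective f)) //.
  apply: eq_card => j; rewrite inE; apply/existsP/imsetP.
    move=> [s /eqP ijs]; exists s => //; apply: val_inj => /=.
    by rewrite -ijs modn_small.
  move=> [s _ ->]; exists s => /=; by rewrite modn_mod.
move=> s t /(congr1 val) /= /eqP; rewrite eqn_modDl.
rewrite !modn_small ?(leq_trans (ltn_ord _) kn) // => /eqP; exact: val_inj.
Qed.

(** The neighbours of [j] are the residues [j - s], with [- s] encoded as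
    [n - s]. *)
Lemma card_cyclic_adj_col (n k : nat) (j : 'I_n) : (k <= n)%N ->
  #|[pred i | cyclic_adj k i j]| = k.
Proof.
move=> kn; have n0 : (0 < n)%N by case: n j kn => [[]|].
pose f (s : 'I_k) : 'I_n := Ordinal (ltn_pmod (j + (n - s)) n0).
have sn (s : 'I_k) : (s < n)%N := leq_trans (ltn_ord s) kn.
rewrite -[RHS]card_ord -(card_imset _ (_ : injective f)) //.
  apply: eq_card => i; rewrite inE; apply/existsP/imsetP.
    move=> [s /eqP ijs]; exists s => //; apply: val_inj => /=.
    rewrite -modnDml ijs modnDml -addnA subnKC 1?ltnW //.
    by rewrite modnDr modn_small.
  move=> [s _ ->]; exists s => /=.
  by rewrite modnDml -addnA subnK 1?ltnW // modnDr.
move=> s t /(congr1 val) /= /eqP; rewrite eqn_modDl => nst; apply: val_inj.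
have: (n - s + (s + t) == n - t + (s + t) %[mod n])%N by rewrite eqn_modDr.
have ss := sn s; have st := sn t.
have -> : (n - s + (s + t) = t + n)%N by lia.
have -> : (n - t + (s + t) = s + n)%N by lia.
by rewrite !modnDr !modn_small // => /eqP.
Qed.

Lemma sum_if_const (R : realType) (T : finType) (P : pred T) (n k : nat) (u v : R) :
  #|T| = n -> #|P| = k ->
  \sum_x (if P x then u else v) = k%:R * u + (n - k)%N%:R * v.
Proof.
move=> <- <-; rewrite (bigID P) /= (eq_bigr (fun=> u)); last by move=> x ->.
rewrite [X in _ + X](eq_bigr (fun=> v)); last by move=> x /negbTE ->.
rewrite !sumr_const !mulr_natl; congr (_ + _ *+ _).
by rewrite -(cardC P) addKn; apply: eq_card.
Qed.

Section chunk_sums.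
Context {R : realType}.

Definition chunk_sum (n : nat) (a : R) : R := 1 + (n - 1)%N%:R * expR (- a).

Definition cross_sum (n k : nat) (c d : R) : R :=
  k%:R * expR (- c) + (n - k)%N%:R * expR (- d).

Lemma sum_chunk (n : nat) (a : R) (i : 'I_n) :
  \sum_(j < n) expR (- (if i == j then 0 else a)) = chunk_sum n a.
Proof.
rewrite (eq_bigr (fun j => if i == j then 1 else expR (- a))); last first.
  by move=> j _; case: ifP; rewrite ?oppr0 ?expR0.
rewrite (@sum_if_const _ 'I_n (eq_op i) n 1) ?card_ord ?mul1r //.
by rewrite -(card1 i); apply: eq_card => j; rewrite !inE eq_sym.
Qed.

Lemma sum_cross_row (n k : nat) (c d : R) (i : 'I_n) : (k <= n)%N ->
  \sum_(j < n) expR (- (if cyclic_adj k i j then c else d)) = cross_sum n k c d.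
Proof.
move=> kn; rewrite /cross_sum -(@sum_if_const _ 'I_n (cyclic_adj k i) n k).
- by apply: eq_bigr => j _; case: ifP.
- exact: card_ord.
- exact: card_cyclic_adj_row.
Qed.

Lemma sum_cross_col (n k : nat) (c d : R) (j : 'I_n) : (k <= n)%N ->
  \sum_(i < n) expR (- (if cyclic_adj k i j then c else d)) = cross_sum n k c d.
Proof.
move=> kn; rewrite /cross_sum -(@sum_if_const _ 'I_n (fun i => cyclic_adj k i j) n k).
- by apply: eq_bigr => i _; case: ifP.
- exact: card_ord.
- exact: card_cyclic_adj_col.
Qed.

Lemma two_chunk_sym (n k : nat) (a b c d : R) x y :
  two_chunk_matrix (n := n) k a b c d x y = two_chunk_matrix (n := n) k a b c d y x.
Proof. by case: x y => i [] j //=; rewrite eq_sym. Qed.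

(** Sum the equations of the weighting over the rows of one chunk and exchange
    the sums: each column contributes its weight times a column sum depending
    only on its chunk. *)
Lemma weighting_chunk_totals (n k : nat) (a b c d : R) :
  (k <= n)%N -> has_magnitude (two_chunk_matrix (n := n) k a b c d) ->
  exists p q, [/\ chunk_sum n a * p + cross_sum n k c d * q = n%:R,
    cross_sum n k c d * p + chunk_sum n b * q = n%:R &
    Mag (two_chunk_matrix (n := n) k a b c d) = p + q].
Proof.
set D := two_chunk_matrix _ _ _ _ _; move=> kn [w Dw].
pose v x := w (enum_rank x) 0.
have Dv x : \sum_y expR (- D x y) * v y = 1 by move/weightingP: Dw; apply.
exists (\sum_i v (inl i)), (\sum_i v (inr i)).
split; last first.
- by rewrite (MagE _ Dw) ?sum_enum_rank ?big_sumType //; exact: two_chunk_sym.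
- have <- : \sum_(i < n) \sum_y expR (- D (inr i) y) * v y = n%:R.
    by rewrite (eq_bigr (fun=> 1)) // sumr_const card_ord.
  rewrite exchange_big big_sumType /= !mulr_sumr; congr (_ + _); apply: eq_bigr => j _.
    by rewrite -mulr_suml (sum_cross_row c d j kn).
  rewrite -mulr_suml -(sum_chunk b j); congr (_ * _).
  by apply: eq_bigr => i _; rewrite eq_sym.
- have <- : \sum_(i < n) \sum_y expR (- D (inl i) y) * v y = n%:R.
    by rewrite (eq_bigr (fun=> 1)) // sumr_const card_ord.
  rewrite exchange_big big_sumType /= !mulr_sumr; congr (_ + _); apply: eq_bigr => j _.
    rewrite -mulr_suml -(sum_chunk a j); congr (_ * _).
    by apply: eq_bigr => i _; rewrite eq_sym.
  by rewrite -mulr_suml (sum_cross_col c d j kn).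
Qed.

(** Cramer's rule for the two totals, spread evenly over each chunk. *)
Lemma two_chunk_has_magnitude (n k : nat) (a b c d : R) : (k <= n)%N ->
  chunk_sum n a * chunk_sum n b - cross_sum n k c d ^+ 2 != 0 ->
  has_magnitude (two_chunk_matrix (n := n) k a b c d).
Proof.
set A := chunk_sum n a; set B := chunk_sum n b; set C := cross_sum n k c d.
move=> kn D0.
pose p := (B - C) / (A * B - C ^+ 2); pose q := (A - C) / (A * B - C ^+ 2).
exists (\col_i (if enum_val i is inl _ then p else q)).
have val x : (\col_i (if enum_val i is inl _ then p else q)) (enum_rank x) 0
    = if x is inl _ then p else q by rewrite mxE enum_rankK.
apply/weightingP => x; under eq_bigr do rewrite val.
rewrite big_sumType /= -!mulr_suml; case: x => i /=.
  rewrite sum_chunk (sum_cross_row c d i kn) -/A -/C /p /q.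
  by field.
rewrite sum_chunk (sum_cross_col c d i kn) -/B -/C /p /q.
by field.
Qed.

End chunk_sums.

(** * Second-order behaviour of balanced spaces at small scale *)

Section small_scale.
Context {R : realType}.
Variables (n k : nat) (a b c d : R).
Hypotheses (n0 : (0 < n)%N) (kn : (k <= n)%N) (bal : balanced n k a b c d).

Lemma rescale_two_chunk (t : R) :
  rescale t (two_chunk_matrix (n := n) k a b c d) =
  two_chunk_matrix (n := n) k (t * a) (t * b) (t * c) (t * d).
Proof.
apply/funext => x; apply/funext => y; rewrite /rescale.
by case: x y => i [] j /=; case: ifP; rewrite ?mulr0.
Qed.

Let A t := chunk_sum n (t * a).
Let B t := chunk_sum n (t * b).
Let C t := cross_sum n k (t * c) (t * d).

(** The coefficient of [t ^+ 2] in [A t * B t - C t ^+ 2], see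
    [cvg_determinant]. *)
Definition det_order2 : R :=
  (n - 1)%N%:R / 2 * (a ^+ 2 + b ^+ 2) - k%:R * (n - k)%N%:R * (c - d) ^+ 2.

(** The gap between the second-order coefficients of [n (A + B - 2 C)] and of
    [A B - C^2]; a square, which is why the sign of [det_order2] decides on
    which side of 1 the limit lies. *)
Definition imbalance : R := ((n - 1)%N%:R * (a - b) / 2) ^+ 2.

Let n1E : (n - 1)%N%:R = n%:R - 1 :> R. Proof. exact: natrB. Qed.
Let nkE : (n - k)%N%:R = n%:R - k%:R :> R. Proof. exact: natrB. Qed.

Let balE : k%:R * c + (n - k)%N%:R * d = (n - 1)%N%:R * (a + b) / 2.
Proof. by rewrite -bal mulrAC divff ?mul1r // pnatr_eq0. Qed.

Lemma cvg_chunk_sum (x : R) : chunk_sum n (t * x) @[t --> 0^'+] --> (n%:R : R).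
Proof.
have -> : n%:R = 1 + (n - 1)%N%:R * 1 :> R by rewrite n1E; ring.
apply: cvgD; first exact: cvg_cst.
by apply: cvgMr; exact: cvg_expR_lin.
Qed.

Lemma cvg_cross_sum : C t @[t --> 0^'+] --> (n%:R : R).
Proof.
have -> : n%:R = k%:R * 1 + (n - k)%N%:R * 1 :> R by rewrite nkE; ring.
by apply: cvgD; apply: cvgMr; exact: cvg_expR_lin.
Qed.

Lemma cvg_chunk_defect (x : R) :
  (n%:R - chunk_sum n (t * x)) / t @[t --> 0^'+] --> (n - 1)%N%:R * x.
Proof.
have -> : (fun t => (n%:R - chunk_sum n (t * x)) / t) =
    (fun t => (n - 1)%N%:R * ((1 - expR (- (t * x))) / t)).
  by apply/funext => t; rewrite /chunk_sum n1E; ring.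
by apply: cvgMr; exact: cvg_expR_order1.
Qed.

Lemma cvg_cross_defect :
  (n%:R - C t) / t @[t --> 0^'+] --> k%:R * c + (n - k)%N%:R * d.
Proof.
have -> : (fun t => (n%:R - C t) / t) =
    (fun t => k%:R * ((1 - expR (- (t * c))) / t) +
              (n - k)%N%:R * ((1 - expR (- (t * d))) / t)).
  by apply/funext => t; rewrite /C /cross_sum nkE; ring.
by apply: cvgD; apply: cvgMr; exact: cvg_expR_order1.
Qed.

(** Balancedness kills the linear terms, so they can be added for free to turn
    each exponential into its second-order remainder. *)
Lemma cvg_numerator :
  n%:R * (A t + B t - 2 * C t) / t ^+ 2 @[t --> 0^'+] --> det_order2 + imbalance.
Proof.
pose f x t : R := (expR (- (t * x)) - 1 + t * x) / t ^+ 2.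
have -> : (fun t => n%:R * (A t + B t - 2 * C t) / t ^+ 2) =
    (fun t => n%:R * ((n - 1)%N%:R * (f a t + f b t) -
                      2 * (k%:R * f c t + (n - k)%N%:R * f d t))).
  apply/funext => t; rewrite /A /B /C /chunk_sum /cross_sum /f.
  have lin : (n - 1)%N%:R * (t * a + t * b) -
      2 * (k%:R * (t * c) + (n - k)%N%:R * (t * d)) = 0.
    move: bal; rewrite /balanced => H.
    have -> : (n - 1)%N%:R * (t * a + t * b) -
      2 * (k%:R * (t * c) + (n - k)%N%:R * (t * d)) =
      t * ((n - 1)%N%:R * (a + b) - 2 * (k%:R * c + (n - k)%N%:R * d)) by ring.
    by rewrite H subrr mulr0.
  transitivity (n%:R * ((1 + (n - 1)%N%:R * expR (- (t * a)) +
    (1 + (n - 1)%N%:R * expR (- (t * b))) -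
    2 * (k%:R * expR (- (t * c)) + (n - k)%N%:R * expR (- (t * d)))) +
    ((n - 1)%N%:R * (t * a + t * b) -
      2 * (k%:R * (t * c) + (n - k)%N%:R * (t * d)))) / t ^+ 2).
    by rewrite lin addr0.
  by rewrite n1E nkE; ring.
have -> : det_order2 + imbalance =
    n%:R * ((n - 1)%N%:R * (a ^+ 2 / 2 + b ^+ 2 / 2) -
            2 * (k%:R * (c ^+ 2 / 2) + (n - k)%N%:R * (d ^+ 2 / 2))).
  (* Koenig-Huygens: weighted mean square = squared mean + variance. *)
  have V : n%:R * (k%:R * c ^+ 2 + (n - k)%N%:R * d ^+ 2) =
     ((n - 1)%N%:R * (a + b) / 2) ^+ 2 + k%:R * (n - k)%N%:R * (c - d) ^+ 2.
    by rewrite -balE nkE; ring.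
  transitivity (n%:R * (n - 1)%N%:R * (a ^+ 2 + b ^+ 2) / 2 -
     n%:R * (k%:R * c ^+ 2 + (n - k)%N%:R * d ^+ 2)); last by field.
  by rewrite V /det_order2 /imbalance n1E; field.
apply: cvgMr; apply: cvgB; apply: cvgMr; apply: cvgD.
- exact: cvg_expR_order2.
- exact: cvg_expR_order2.
- by apply: cvgMr; exact: cvg_expR_order2.
- by apply: cvgMr; exact: cvg_expR_order2.
Qed.

(** Expanding around [n], where all three row sums tend, gives
    [A B - C^2 = n (A + B - 2 C) + (n - A) (n - B) - (n - C)^2]. *)
Lemma cvg_determinant :
  (A t * B t - C t ^+ 2) / t ^+ 2 @[t --> 0^'+] --> det_order2.
Proof.
have -> : (fun t => (A t * B t - C t ^+ 2) / t ^+ 2) =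
    (fun t => n%:R * (A t + B t - 2 * C t) / t ^+ 2 +
     (((n%:R - A t) / t) * ((n%:R - B t) / t) -
      ((n%:R - C t) / t) * ((n%:R - C t) / t))).
  by apply/funext => t; rewrite -exprVn; ring.
have -> : det_order2 = det_order2 + imbalance +
    (((n - 1)%N%:R * a) * ((n - 1)%N%:R * b) -
     (k%:R * c + (n - k)%N%:R * d) * (k%:R * c + (n - k)%N%:R * d)).
  by rewrite balE /imbalance; field.
apply: cvgD; first exact: cvg_numerator.
by apply: cvgB; apply: cvgM; first [exact: cvg_chunk_defect|exact: cvg_cross_defect].
Qed.

Let M := two_chunk_matrix (n := n) k a b c d.

(** The combination of the two total equations with coefficients [B - C] and
    [A - C]; it holds even where the determinant vanishes. *)
Lemma Mag_eq (t : R) : has_magnitude (rescale t M) ->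
  (A t * B t - C t ^+ 2) * Mag (rescale t M) = n%:R * (A t + B t - 2 * C t).
Proof.
rewrite rescale_two_chunk => /(weighting_chunk_totals kn).
move=> [p [q [e1 e2 ->]]]; rewrite -/(A t) -/(B t) -/(C t) in e1 e2 *.
transitivity ((B t - C t) * (A t * p + C t * q) +
  (A t - C t) * (C t * p + B t * q)); first by ring.
by rewrite e1 e2; ring.
Qed.

Lemma small_scale_Mag_eq (l : R) : small_scale_Mag M l ->
  det_order2 * l = det_order2 + imbalance.
Proof.
move=> [hM Ml]; apply: (cvg_unique (@Rhausdorff R) _ cvg_numerator).
apply: cvg_trans (cvgM cvg_determinant Ml); apply: near_eq_cvg.
near=> t; rewrite /= mulrAC Mag_eq //.
by near: t.
Unshelve. all: by end_near. Qed.

(** Here [A = B], so adding the two total equations gives [(A + C) Mag = 2 n]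
    with [A + C] tending to [2 n].  This covers also the case where
    [A B - C^2] vanishes to higher order, about which [small_scale_Mag_eq] says
    nothing. *)
Lemma small_scale_Mag_sym (l : R) : a = b -> small_scale_Mag M l -> l = 1.
Proof.
move=> ab [hM Ml].
have n00 : n%:R + n%:R != 0 :> R by rewrite -natrD pnatr_eq0; lia.
suff e : (n%:R + n%:R) * l = n%:R + n%:R by apply: (mulfI n00); rewrite mulr1.
have H1 : (A t + C t) * Mag (rescale t M) @[t --> 0^'+] --> (n%:R + n%:R) * l.
  by apply: cvgM => //; apply: cvgD; [exact: cvg_chunk_sum|exact: cvg_cross_sum].
apply: (cvg_unique (@Rhausdorff R) H1).
have H2 : (fun=> n%:R + n%:R : R) @ (0 : R)^'+ --> (n%:R + n%:R : R) by exact: cvg_cst.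
apply: cvg_trans H2.
apply: near_eq_cvg; near=> t.
have : has_magnitude (rescale t M) by near: t.
rewrite rescale_two_chunk => /(weighting_chunk_totals kn) [p [q [e1 e2 ->]]].
rewrite -ab in e2; rewrite /A /C -{1}e1 -e2; ring.
Unshelve. all: by end_near. Qed.

Lemma small_scale_MagP : det_order2 != 0 ->
  small_scale_Mag M ((det_order2 + imbalance) / det_order2).
Proof.
move=> D0.
have nD : \forall t \near 0^'+, A t * B t - C t ^+ 2 != 0.
  apply: filterS (cvgr_neq0 _ cvg_determinant D0) => t.
  by apply: contraNneq => ->; rewrite mul0r.
have hM : \forall t \near 0^'+, has_magnitude (rescale t M).
  apply: filterS nD => t nt; rewrite rescale_two_chunk.
  exact: two_chunk_has_magnitude.
split => //.
apply: cvg_trans (cvgM cvg_numerator (cvgV D0 cvg_determinant)); apply: near_eq_cvg; near=> t.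
have t0 : 0 < t by near: t; exact: nbhs_right_gt.
have ht : has_magnitude (rescale t M) by near: t.
have dt : A t * B t - C t ^+ 2 != 0 by near: t.
rewrite /= -(Mag_eq ht); field; rewrite dt; lra.
Unshelve. all: by end_near. Qed.

End small_scale.

(** * Triangle inequalities and the case of six points per chunk *)

Section triangle_inequalities.
Context {R : realType}.

(** A triangle with vertices in both chunks has one side inside a chunk and two
    sides across: either two equal ones, whence the bounds by [c + c] and
    [d + d], or one of each length, whence those on [|c - d|]. *)
Lemma two_chunk_distance (n k : nat) (a b c d : R) :
  0 < a -> 0 < b -> 0 < c -> 0 < d ->
  a <= c + c -> a <= d + d -> b <= c + c -> b <= d + d ->
  `|c - d| <= a -> `|c - d| <= b ->
  distance_matrix (two_chunk_matrix (n := n) k a b c d).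
Proof.
move=> a0 b0 c0 d0 ac ad bc bd.
rewrite !ler_norml => /andP[a1 a2] /andP[b1 b2]; split.
- by case=> i /=; rewrite eqxx.
- by move=> [] i [] j /= ij; case: ifP => // /eqP e; rewrite e eqxx in ij.
- exact: two_chunk_sym.
- have triA (m : R) (i j l : 'I_n) : 0 < m -> (if i == j then 0 else m) <=
      (if i == l then 0 else m) + (if l == j then 0 else m).
    move=> m0; have [->|il] := eqVneq i l; first by rewrite add0r.
    by case: ifP => _; case: ifP => _; lra.
  by move=> [] i [] j [] l /=; rewrite ?triA // ?[j == l]eq_sym;
    try (have [->|_] := eqVneq i l); try (have [->|_] := eqVneq j l);
    try (have [->|_] := eqVneq i j);
    rewrite ?eqxx; repeat case: ifP => _; lra.
Qed.

(** A form of the adjacency that computes on concrete indices. *)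
Lemma cyclic_adjE (n k : nat) (i j : 'I_n) : (k <= n)%N ->
  cyclic_adj k i j = ((j + (n - i)) %% n < k)%N.
Proof.
move=> kn; have n0 : (0 < n)%N := leq_ltn_trans (leq0n i) (ltn_ord i).
have ni := ltn_ord i.
apply/existsP/idP => [[s /eqP e]|ltk].
  rewrite -modnDml e modnDml addnAC (subnKC (ltnW ni)) modnDl.
  by rewrite modn_small // (leq_trans (ltn_ord s) kn).
exists (Ordinal ltk) => /=; rewrite modnDmr addnCA (subnKC (ltnW ni)).
by rewrite modnDr.
Qed.

Let o (i : nat) : 'I_6 := inord i.

(** For [k = 1] each edge inside a chunk spans a triangle whose other sides are
    [c] and [d], so [|c - d|] is at most [min a b]; and
    [k (n - k) = n - 1]. *)
Lemma det_order2_ge0_k1 (a b c d : R) :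
  two_chunk_space 6 1 a b c d -> 0 <= det_order2 6 1 a b c d.
Proof.
move=> [_ _ [a0 b0 c0 d0] [_ _ _ tri]].
have adj i j : (i < 6)%N -> (j < 6)%N ->
   cyclic_adj 1 (o i) (o j) = ((j + (6 - i)) %% 6 < 1)%N.
  by move=> i6 j6; rewrite cyclic_adjE // !inordK.
have := tri (inl (o 0)) (inr (o 0)) (inl (o 1)).
have := tri (inl (o 0)) (inr (o 1)) (inl (o 1)).
have := tri (inl (o 0)) (inr (o 0)) (inr (o 1)).
have := tri (inl (o 0)) (inr (o 1)) (inr (o 0)).
rewrite /= -!/(cyclic_adj _ _ _) !adj //=.
rewrite -!(inj_eq val_inj) /= !inordK //= => h1 h2 h3 h4.
rewrite /det_order2.
have -> : (6 - 1)%N = 5%N by [].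
have ha : 0 <= (a - (c - d)) * (a + (c - d)) by apply: mulr_ge0; lra.
have hb : 0 <= (b - (c - d)) * (b + (c - d)) by apply: mulr_ge0; lra.
lra.
Qed.

(** For [k = 3] there are points with a common [c]-neighbour and with a
    common [d]-neighbour in each chunk, so that [a] and [b] are at
    most [2 min c d]; balancedness fixes [c + d], which turns
    this into a bound on [|c - d|]. *)
Lemma det_order2_ge0_k3 (a b c d : R) :
  two_chunk_space 6 3 a b c d -> balanced 6 3 a b c d ->
  0 <= det_order2 6 3 a b c d.
Proof.
move=> [_ _ [a0 b0 c0 d0] [_ _ _ tri]].
have adj i j : (i < 6)%N -> (j < 6)%N ->
   cyclic_adj 3 (o i) (o j) = ((j + (6 - i)) %% 6 < 3)%N.
  by move=> i6 j6; rewrite cyclic_adjE // !inordK.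
have := tri (inl (o 0)) (inl (o 1)) (inr (o 1)).
have := tri (inl (o 0)) (inl (o 1)) (inr (o 4)).
have := tri (inr (o 0)) (inr (o 1)) (inl (o 0)).
have := tri (inr (o 0)) (inr (o 1)) (inl (o 2)).
rewrite /= -!/(cyclic_adj _ _ _) !adj //=.
rewrite -!(inj_eq val_inj) /= !inordK //= => h1 h2 h3 h4.
rewrite /balanced /det_order2.
have -> : (6 - 1)%N = 5%N by [].
have -> : (6 - 3)%N = 3%N by [].
move=> bal.
(* [6 (c + d) = 5 (a + b)] and [a <= 2 min c d] give
   [6 |c - d| <= 5 b - a]; it is the larger of [a] and [b]
   that gives the stronger bound. *)
have [ba|/ltW ab] := lerP b a.
  have h : 0 <= ((5 * b - a) / 2 - 3 * (c - d)) * ((5 * b - a) / 2 + 3 * (c - d)).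
    by apply: mulr_ge0; lra.
  nra.
have h : 0 <= ((5 * a - b) / 2 - 3 * (c - d)) * ((5 * a - b) / 2 + 3 * (c - d)).
  by apply: mulr_ge0; lra.
nra.
Qed.

(** If [a != b] then [imbalance] is positive, so a limit below 1 would make
    [det_order2] negative; if [a = b] the limit is 1 anyway. *)
Lemma no_limit_lt1 (k : nat) (a b c d l : R) : (k <= 6)%N ->
  balanced 6 k a b c d -> 0 <= det_order2 6 k a b c d ->
  small_scale_Mag (two_chunk_matrix (n := 6) k a b c d) l -> 1 <= l.
Proof.
move=> k6 bal D0 Ml; rewrite leNgt; apply/negP => l1.
have [ab|ab] := eqVneq a b.
  by rewrite (small_scale_Mag_sym _ k6 ab Ml) // ltxx in l1.
have := small_scale_Mag_eq (isT : (0 < 6)%N) k6 bal Ml.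
have E0 : 0 < imbalance 6 a b.
  by rewrite /imbalance exprn_even_gt0 //= !mulf_neq0 ?invr_eq0 ?pnatr_eq0 ?subr_eq0.
nra.
Qed.

(** With [a = 1] and [b = 1 + e] for a small [e], solve
    [det_order2 * (r - 1) = imbalance] for [v = c - d] and then the
    balanced condition for [d].  At [e = 0] this gives [v = sqrt (5 / 8)],
    about 0.79, and [d] about 0.57, where the triangle inequalities hold
    with room to spare. *)
Lemma exists_limit (r : R) : r <> 1 ->
  exists a b c d : R, [/\ two_chunk_space 6 2 a b c d, balanced 6 2 a b c d &
    small_scale_Mag (two_chunk_matrix (n := 6) 2 a b c d) r].
Proof.
move=> /eqP; rewrite -subr_eq0; set s := r - 1 => s0.
have [e [q [e0 e1 qs qe]]] : exists e q : R,
    [/\ 0 < e, e <= 1 / 100, q * s = e ^+ 2 & `|q| <= 1 / 100].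
  (* [q] is [imbalance / (r - 1)] up to the factor 25/4; it is small because
     [e <= |r - 1|]. *)
  pose e := Num.min (1 / 100) `|s|.
  have e0 : 0 < e by rewrite lt_min normr_gt0 s0 andbT; lra.
  have e1 : e <= 1 / 100 by rewrite ge_min lexx.
  exists e, (e ^+ 2 / s); split => //; first by rewrite divfK.
  rewrite normrM normfV ler_pdivrMr ?normr_gt0 // ger0_norm ?sqr_ge0 // expr2.
  by apply: ler_pM; rewrite ?(ltW e0) // ge_min lexx orbT.
move: qe; rewrite ler_norml => /andP[q1 q2].
pose w := (5 / 2 * (1 + (1 + e) ^+ 2) - 25 / 4 * q) / 8.
(* 0.78 and 0.81 enclose [sqrt (5 / 8)] widely enough to absorb [e] and [q]. *)
have w1 : 78 / 100 * (78 / 100) <= w by rewrite /w; nra.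
have w2 : w <= 81 / 100 * (81 / 100) by rewrite /w; nra.
pose v := Num.sqrt w.
have vv : v ^+ 2 = w by rewrite sqr_sqrtr //; lra.
have v0 : 0 <= v by exact: sqrtr_ge0.
have v1 : 78 / 100 <= v by nra.
have v2 : v <= 81 / 100 by nra.
pose d := (5 * (2 + e) - 4 * v) / 12.
have d1 : 56 / 100 <= d by rewrite /d; lra.
have d2 : d <= 60 / 100 by rewrite /d; lra.
have bal : balanced 6 2 1 (1 + e) (d + v) d.
  rewrite /balanced; have -> : (6 - 1)%N = 5%N by [].
  have -> : (6 - 2)%N = 4%N by [].
  rewrite /d; lra.
have q0 : q != 0.
  by apply: contraTneq e0 => q0; move: qs; rewrite q0 mul0r => /esym/eqP;
    rewrite sqrf_eq0 => /eqP ->; rewrite ltxx.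
have DE : det_order2 6 2 1 (1 + e) (d + v) d = 25 / 4 * q.
  rewrite /det_order2; have -> : (6 - 1)%N = 5%N by [].
  have -> : (6 - 2)%N = 4%N by [].
  have -> : d + v - d = v by ring.
  by rewrite vv /w; field.
exists 1, (1 + e), (d + v), d; split => //.
  split => //; first by split; lra.
  apply: two_chunk_distance; try lra.
  - by rewrite ler_norml; apply/andP; split; lra.
  - by rewrite ler_norml; apply/andP; split; lra.
have := @small_scale_MagP R 6 2 1 (1 + e) (d + v) d isT isT bal.
rewrite DE; have -> : imbalance 6 1 (1 + e) = 25 / 4 * (q * s).
  by rewrite qs /imbalance; have -> : (6 - 1)%N = 5%N by []; field.
have -> : (25 / 4 * q + 25 / 4 * (q * s)) / (25 / 4 * q) = r.
  by rewrite /s; field.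
by apply; rewrite mulf_neq0 //; lra.
Qed.

End triangle_inequalities.

Theorem proposition5p2 (R : realType) :
  [/\ forall k : nat, (k = 1 \/ k = 3)%N ->
        ~ exists alpha beta gamma delta : R,
            [/\ two_chunk_space 6 k alpha beta gamma delta,
                balanced 6 k alpha beta gamma delta &
                exists l : R,
                  small_scale_Mag
                    (two_chunk_matrix (n := 6) k alpha beta gamma delta) l /\
                  l < 1],
      forall r : R, r <> 1 ->
        exists alpha beta gamma delta : R,
          [/\ two_chunk_space 6 2 alpha beta gamma delta,
              balanced 6 2 alpha beta gamma delta &
              small_scale_Mag
                (two_chunk_matrix (n := 6) 2 alpha beta gamma delta) r] &
      exists (T : finType) (d : T -> T -> R),
        [/\ distance_matrix d, #|T| = 12%N &
            exists l : R, small_scale_Mag d l /\ l < 1]].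
Proof.
split.
- move=> k kE [a [b [c [d [X bal [l [Ml]]]]]]]; apply/negP; rewrite -leNgt.
  case: kE => kE; rewrite {}kE in X bal Ml.
    exact: no_limit_lt1 bal (det_order2_ge0_k1 X) Ml.
  exact: no_limit_lt1 bal (det_order2_ge0_k3 X bal) Ml.
- exact: exists_limit.
- have [|a [b [c [d [[_ _ _ dX] _ MX]]]]] := @exists_limit R 0.
    by apply/eqP; rewrite eq_sym oner_neq0.
  exists ('I_6 + 'I_6)%type, (two_chunk_matrix (n := 6) 2 a b c d).
  by split; rewrite ?card_sum ?card_ord //; exists 0; split => //; exact: ltr01.
Qed.
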